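(* Let $d\geq 1$, let $p\in[0,1]$ with $p>p_d=\frac{2d+1}{4d}$, let $(S_n)$ be the $d$-dimensional elephant random walk with memory parameter $p$, let $a=\frac{2dp-1}{2d-1}$, and let $G_n=\frac{1}{n}\sum_{k=1}^n S_k$. Then there exists a non-degenerate random vector $G$ of $\mathbb{R}^d$ such that $$\lim_{n\to\infty}\frac{1}{n^a}G_n=G\quad\text{a.s.}$$ and $$\lim_{n\to\infty}\mathbb{E}\Bigl[\Bigl\|\frac{1}{n^a}G_n-G\Bigr\|^2\Bigr]=0.$$
   Context: The $d$-dimensional elephant random walk (ERW) with memory parameter $p\in[0,1]$ is defined as follows. Let $e_1,\dots,e_d$ be the standard basis of $\mathbb{R}^d$; the $2d$ directions are $\pm e_1,\dots,\pm e_d$. Set $S_0=0$. The first step $X_1$ is uniformly distributed on the $2d$ directions. For $n\geq 1$, given $X_1,\dots,X_n$, an index $k$ is chosen uniformly at random in $\{1,\dots,n\}$, and then $X_{n+1}=X_k$ with probability $p$, while $X_{n+1}$ equals each of the $2d-1$ remaining directions with probability $(1-p)/(2d-1)$. The position is $S_{n+1}=S_n+X_{n+1}$. The case $p>p_d$ is the superdiffusive regime. *)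

(* Defs.v *)
From HB Require Import structures.
From mathcomp Require Import all_boot all_order all_algebra.
From mathcomp Require Import all_classical all_reals all_analysis.
Set Implicit Arguments. Unset Strict Implicit. Unset Printing Implicit Defensive.
Import Order.TTheory GRing.Theory Num.Theory.
Local Open Scope ring_scope.

(* The 2d directions +/- e_i are encoded as pairs (i, sign), sign = true for +e_i. *)
Definition dir (d : nat) := ('I_d * bool)%type.

Definition dvec {R : nzRingType} (d : nat) (x : dir d) : 'rV[R]_d :=
  \row_j (if j == x.1 then (if x.2 then 1 else -1) else 0).

(* Probability that the next step equals y given that the chosen past step was x. *)
Definition erw_weight {R : fieldType} (d : nat) (p : R) (x y : dir d) : R :=
  if x == y then p else (1 - p) / (2 * d - 1)%:R.

(* erw_prob p xs n = P(X_1 = xs 1, ..., X_n = xs n) for the d-dimensional ERW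
   with memory parameter p. *)
Fixpoint erw_prob {R : fieldType} (d : nat) (p : R) (xs : nat -> dir d) (n : nat) : R :=
  match n with
  | 0 => 1
  | m.+1 =>
      if m is 0 then ((2 * d)%:R)^-1
      else erw_prob p xs m *
             ((m%:R)^-1 * \sum_(1 <= k < m.+1) erw_weight p (xs k) (xs m.+1))
  end.

Definition erw_pos {R : nzRingType} (d : nat) (T : Type) (X : nat -> T -> dir d)
  (n : nat) (t : T) : 'rV[R]_d :=
  \sum_(1 <= k < n.+1) dvec (X k t).

Definition erw_bary {R : fieldType} (d : nat) (T : Type) (X : nat -> T -> dir d)
  (n : nat) (t : T) : 'rV[R]_d :=
  (n%:R)^-1 *: \sum_(1 <= k < n.+1) erw_pos X k t.

Definition sqnorm {R : nzRingType} (d : nat) (v : 'rV[R]_d) : R :=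
  \sum_(i < d) v 0 i ^+ 2.

(* Main.v *)
(** Project the walk on a vector u: the real steps x_k satisfy
    E[x_k x_(n+1)] = (a / n) E[x_k S_n] for k <= n, so that, with
    A_n = prod_(k < n) (1 + a / k) ~ l n^a, the sequence M_n = S_n / A_n has
    orthogonal increments with E[(M_(n+1) - M_n)^2] = O(n^(-2a)); since 2a > 1,
    M_n is Cauchy in L^2 at rate n^(1 - 2a).  No martingale convergence theorem
    is needed, because the barycentre is an average: up to a deterministic
    convergent factor, G_n / n^a is Z_n = (sum_(k <= n) A_k M_k) / (sum_(k <= n) A_k),
    whose increments (1 + a) / n * (M_(n+1) - Z_(n+1)) have summable L^1 norms.
    Hence Z_n converges almost surely, and in L^2 by Fatou's lemma.  Finally
    E[Z_n x_1] = E[x_1^2] > 0 = E[x_1] for every n, so the limit cannot be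
    almost surely constant; applied to every u this is non-degeneracy. *)

Require Import Defs.
From HB Require Import structures.
From mathcomp Require Import all_boot all_order all_algebra.
From mathcomp Require Import all_classical all_reals all_analysis.
From mathcomp Require Import measurable_realfun ring lra.
Import Order.TTheory GRing.Theory Num.Theory.
Import numFieldNormedType.Exports.
Local Open Scope ring_scope.

Set Implicit Arguments. Unset Strict Implicit.

(** * Growth of the normalising products and of their partial sums *)

Section Growth.
Variable R : realType.
Implicit Types (a r s x : R) (n k m : nat).

(** Bernoulli's inequality for exponents in [0, 1]. With m the right-hand side, [ln u <= u - 1] is
    applied at u = (1 + x) / m and u = 1 / m with weights r and 1 - r; these two points average to
    1, so the weighted logarithms sum to at most 0. *)
Lemma powR_le_linear x r : -1 < x -> 0 <= r <= 1 -> (1 + x) `^ r <= 1 + r * x.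
Proof.
move=> x1 /andP[r0 r1].
have y0 : 0 < 1 + x by lra.
have m0 : 0 < 1 + r * x.
  have [->|rn0] := eqVneq r 0; first by rewrite mul0r addr0.
  have rp : 0 < r by rewrite lt_neqAle eq_sym rn0.
  have := mulr_gt0 rp y0; lra.
set m := 1 + r * x in m0 *.
have lnle (u : R) : 0 < u -> ln u <= u - 1.
  by move=> u0; have := @le_ln1Dx R (u - 1); rewrite addrCA subrr addr0; apply; lra.
have h1 : ln ((1 + x) / m) <= (1 + x) / m - 1 by apply: lnle; rewrite divr_gt0.
have h2 : ln m^-1 <= m^-1 - 1 by apply: lnle; rewrite invr_gt0.
rewrite lnM ?posrE ?invr_gt0 // in h1.
rewrite lnV ?posrE // in h1 h2.
rewrite /powR gt_eqF // -[leRHS](@lnK R) ?posrE // ler_expR.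
have h3 : r * (1 + x) / m + (1 - r) / m = 1.
  have mn0 : m != 0 by rewrite gt_eqF.
  rewrite -mulrDl -[RHS](divff mn0); congr (_ / _); rewrite /m; ring.
have := ler_wpM2l r0 h1.
have := @ler_wpM2l _ (1 - r) _ _ _ h2.
rewrite subr_ge0 => /(_ r1).
rewrite !mulrBr !mulrA; lra.
Qed.

(** This is Gamma(n + 1 + a) / (Gamma(1 + a) n!), the normaliser of the walk at time n + 1. *)
Definition erw_growth a n : R := \prod_(k < n) (1 + a / k.+1%:R).

Lemma erw_growthS a n : erw_growth a n.+1 = erw_growth a n * (1 + a / n.+1%:R).
Proof. by rewrite /erw_growth big_ord_recr. Qed.

Lemma erw_growth_gt0 a n : 0 <= a -> 0 < erw_growth a n.
Proof.
by move=> a0; apply: prodr_gt0 => k _; rewrite ltr_wpDr // divr_ge0.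
Qed.

Lemma powRS_le a n : 0 <= a <= 1 ->
  n.+2%:R `^ a <= n.+1%:R `^ a * (1 + a / n.+1%:R) :> R.
Proof.
move=> a01.
have -> : n.+2%:R = n.+1%:R * (1 + n.+1%:R^-1) :> R.
  by rewrite mulrDr mulr1 mulfV ?pnatr_eq0 // natr1.
rewrite powRM // ?addr_ge0 // ler_wpM2l ?powR_ge0 //.
apply: powR_le_linear => //; rewrite (lt_le_trans (y := 0)) ?ltrN10 //.
Qed.

(** By Bernoulli, each new factor 1 + a / (n + 1) dominates the growth ((n + 2) / (n + 1))^a of the
    power. *)
Lemma erw_growth_ratio_nondecreasing a : 0 <= a <= 1 ->
  nondecreasing_seq (fun n => erw_growth a n / n.+1%:R `^ a).
Proof.
move=> a01; apply/nondecreasing_seqP => n.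
rewrite erw_growthS ler_pdivlMr ?powR_gt0 // -!mulrA ler_wpM2l //.
  by rewrite ltW // erw_growth_gt0 //; case/andP: a01.
by rewrite mulrC ler_pdivrMr ?powR_gt0 // mulrC powRS_le.
Qed.

Lemma erw_growth_ge a n : 0 <= a <= 1 -> n.+1%:R `^ a <= erw_growth a n.
Proof.
move=> a01; have := @erw_growth_ratio_nondecreasing _ a01 0%N n (leq0n n).
by rewrite /erw_growth big_ord0 powR1 divr1 ler_pdivlMr ?powR_gt0 // mul1r.
Qed.

Lemma erw_growth_le a n : 0 < a <= 1 ->
  erw_growth a n <= (a `^ a)^-1 * n.+1%:R `^ a.
Proof.
move=> /andP[a0 a1].
rewrite ler_pdivlMl ?powR_gt0 //.
(* The induction closes for the shifted power (n + a)^a: it starts with equality at n = 0, which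
   explains the constant a^a, and its step is Bernoulli at -1 / (n + 1 + a). *)
apply: (@le_trans _ _ ((n%:R + a) `^ a)); last first.
  by rewrite ge0_ler_powR ?nnegrE ?addr_ge0 // ?(ltW a0) // -natr1 lerD2l.
elim: n => [|n IH]; first by rewrite /erw_growth big_ord0 mulr1 add0r.
rewrite erw_growthS mulrA.
set m : R := n.+1%:R + a.
have n0 : (0 : R) < n.+1%:R by rewrite ltr0n.
have m0 : 0 < m by rewrite /m addr_gt0.
have -> : 1 + a / n.+1%:R = m / n.+1%:R by rewrite /m mulrDl divff // gt_eqF.
have H : (n%:R + a) `^ a <= m `^ a * (n.+1%:R / m).
  have -> : n%:R + a = m * (1 + - m^-1).
    by rewrite mulrDr mulr1 mulrN mulfV ?gt_eqF // /m -natr1; ring.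
  rewrite powRM ?(ltW m0) //; last first.
    rewrite subr_ge0 invf_le1 // /m -natr1.
    have : (0 : R) <= n%:R by []. lra.
  rewrite ler_wpM2l ?powR_ge0 //.
  apply: (le_trans (powR_le_linear _ _)).
  - by rewrite ltrN2 invf_lt1 // /m -natr1; have : (0 : R) <= n%:R by []; lra.
  - by rewrite (ltW a0).
  - rewrite mulrN ler_pdivlMr // mulrBl mul1r mulfVK ?gt_eqF // /m; lra.
apply: (le_trans (ler_wpM2r _ IH)); first by rewrite divr_ge0 // ltW.
rewrite -ler_pdivlMr ?divr_gt0 // invf_div; exact: H.
Qed.

(** Discrete form of the derivative of -x^(-s). With m = k + 2, Bernoulli gives (m - 1)^s <= m^s (1
    - s / m), and 1 / (1 - s / m) >= 1 + s / m. *)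
Lemma powRN_telescope s k : 0 < s <= 1 ->
  s * k.+2%:R `^ (- s - 1) <= k.+1%:R `^ (- s) - k.+2%:R `^ (- s) :> R.
Proof.
move=> /andP[s0 s1].
set m : R := k.+2%:R.
have m0 : 0 < m by rewrite ltr0n.
have m2 : 2 <= m by rewrite /m ler_nat.
have sm : s / m < 1 by rewrite ltr_pdivrMr //; lra.
have H : k.+1%:R `^ s <= m `^ s * (1 - s / m).
  have -> : k.+1%:R = m * (1 + - m^-1).
    by rewrite mulrDr mulr1 mulrN mulfV ?gt_eqF // /m -(natr1 k.+1) addrK.
  rewrite powRM ?(ltW m0) // ?subr_ge0 ?invf_le1 //; last lra.
  rewrite ler_wpM2l ?powR_ge0 //.
  apply: (le_trans (powR_le_linear _ _)); last by rewrite mulrN.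
    by rewrite ltrN2 invf_lt1 //; lra.
  by rewrite (ltW s0).
have -> : m `^ (- s - 1) = (m `^ s)^-1 / m.
  by rewrite powRD ?(gt_eqF m0) ?implybT // powR_inv1 ?(ltW m0) // powRN.
rewrite !powRN.
have u0 : 0 < m `^ s by rewrite powR_gt0.
have w0 : 0 < k.+1%:R `^ s :> R by rewrite powR_gt0 // ltr0n.
rewrite lerBrDr.
apply: (@le_trans _ _ (m `^ s * (1 - s / m))^-1); last by rewrite lef_pV2 ?posrE // mulr_gt0 // subr_gt0.
rewrite invfM.
have -> : s * ((m `^ s)^-1 / m) + (m `^ s)^-1 = (m `^ s)^-1 * (1 + s / m) by ring.
rewrite ler_wpM2l ?invr_ge0 ?powR_ge0 //.
rewrite -[leRHS]mul1r ler_pdivlMr ?subr_gt0 //.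
have -> : (1 + s / m) * (1 - s / m) = 1 - (s / m) ^+ 2 by ring.
by rewrite gerBl sqr_ge0.
Qed.

Lemma sum_powRN_le s n m : 0 < s <= 1 -> (n <= m)%N ->
  \sum_(n <= k < m) k.+2%:R `^ (- s - 1) <= s^-1 * n.+1%:R `^ (- s).
Proof.
move=> s01 nm; have s0 : 0 < s by case/andP: s01.
suff : s * \sum_(n <= k < m) k.+2%:R `^ (- s - 1)
    <= n.+1%:R `^ (- s) - m.+1%:R `^ (- s).
  rewrite mulrC -ler_pdivlMr // mulrC => /le_trans; apply.
  by rewrite ler_wpM2l ?invr_ge0 ?(ltW s0) // lerBlDr lerDl powR_ge0.
elim: m nm => [|m IH]; first by rewrite leqn0 => /eqP ->; rewrite big_geq // mulr0 subrr.
rewrite leq_eqVlt => /predU1P[->|nm]; first by rewrite big_geq // mulr0 subrr.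
rewrite big_nat_recr //= mulrDr.
by have := lerD (IH nm) (powRN_telescope m s01); rewrite addrA subrK.
Qed.

Definition erw_mass a n : R := \sum_(k < n.+1) erw_growth a k.

Lemma erw_massS a n : erw_mass a n.+1 = erw_mass a n + erw_growth a n.+1.
Proof. by rewrite /erw_mass big_ord_recr. Qed.

(** A hockey-stick identity: the partial sums of these products have a closed form, hence exact
    asymptotics. *)
Lemma erw_massE a n : (1 + a) * erw_mass a n = (n.+1%:R + a) * erw_growth a n.
Proof.
elim: n => [|n IH]; first by rewrite /erw_mass big_ord1.
rewrite erw_massS mulrDr IH erw_growthS.
have n0 : n.+1%:R != 0 :> R by rewrite pnatr_eq0.
rewrite -(natr1 n.+1).
by field; rewrite ?natr1 ?nat1r.
Qed.

Lemma erw_massE_growthS a n :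
  (1 + a) * erw_mass a n = n.+1%:R * erw_growth a n.+1.
Proof.
rewrite erw_massE erw_growthS.
have n0 : n.+1%:R != 0 :> R by rewrite pnatr_eq0.
by field; rewrite ?natr1 ?nat1r.
Qed.

Lemma erw_mass_gt0 a n : 0 <= a -> 0 < erw_mass a n.
Proof.
move=> a0; rewrite /erw_mass big_ord_recr /= ltr_wpDl ?erw_growth_gt0 //.
by apply: sumr_ge0 => k _; rewrite ltW // erw_growth_gt0.
Qed.

Lemma cvg_erw_mass a : 0 < a <= 1 ->
  exists2 g : R, 0 < g &
    ((fun n => erw_mass a n / (n.+1%:R * n.+1%:R `^ a)) @ \oo --> g)%classic.
Proof.
move=> /[dup] a01' /andP[a0 a1].
have a01 : 0 <= a <= 1 by rewrite (ltW a0).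
pose b n := erw_growth a n / n.+1%:R `^ a.
have bnd : forall n, b n <= (a `^ a)^-1.
  by move=> n; rewrite /b ler_pdivrMr ?powR_gt0 ?ltr0n // erw_growth_le.
have cb : cvgn b.
  apply: nondecreasing_is_cvgn; first exact: erw_growth_ratio_nondecreasing.
  by exists (a `^ a)^-1 => _ [n _ <-].
have l1 : 1 <= limn b.
  apply: limr_ge => //; apply: nearW => n.
  by rewrite /b ler_pdivlMr ?powR_gt0 ?ltr0n // mul1r erw_growth_ge.
(* The factor [1 + 0 * a] is left unsimplified so that the limit matches the sequence factor by
   factor. *)
exists ((1 + a)^-1 * (1 + 0 * a) * limn b); first by rewrite mul0r addr0 mulr1 mulr_gt0 ?invr_gt0; lra.
have -> : (fun n => erw_mass a n / (n.+1%:R * n.+1%:R `^ a)) =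
          (fun n => (1 + a)^-1 * (1 + n.+1%:R^-1 * a) * b n).
  apply/funext => n; rewrite /b.
  have n0 : n.+1%:R != 0 :> R by rewrite pnatr_eq0.
  have p0 : n.+1%:R `^ a != 0 :> R by rewrite gt_eqF // powR_gt0 // ltr0n.
  have h : 1 + a != 0 by rewrite gt_eqF //; lra.
  have -> : erw_mass a n = (n.+1%:R + a) * erw_growth a n / (1 + a).
    by rewrite -erw_massE mulrAC divff // mul1r.
  by field; rewrite ?natr1 ?nat1r p0 n0 h.
apply: cvgM => //; apply: cvgM; first exact: cvg_cst.
apply: cvgD; first exact: cvg_cst.
apply: cvgM; last exact: cvg_cst.
exact: cvg_harmonic.
Qed.

End Growth.

(** * Expectations of bounded random variables *)

Section BoundedExpectation.
Context {R : realType} {dT : measure_display} {T : measurableType dT}.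
Variable P : probability T R.
Implicit Types f g : T -> R.

(** Steps take finitely many values, so everything built from finitely many of them lies in this
    class; it is stable under products, hence all moments are available. *)
Definition bounded_rv f : Prop :=
  measurable_fun setT f /\ exists K, forall t, `|f t| <= K.

Definition mean f : R := (\int[P]_t f t)%R.

Lemma bounded_rv_cst (c : R) : bounded_rv (fun=> c).
Proof. by split; [exact: measurable_cst | exists `|c|]. Qed.

Lemma bounded_rvD f g :
  bounded_rv f -> bounded_rv g -> bounded_rv (fun t => f t + g t).
Proof.
move=> [mf [K fK]] [mg [L gL]]; split; first exact: measurable_funD.
exists (K + L) => t; exact: (le_trans (ler_normD _ _) (lerD (fK t) (gL t))).
Qed.

Lemma bounded_rvM f g :
  bounded_rv f -> bounded_rv g -> bounded_rv (fun t => f t * g t).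
Proof.
move=> [mf [K fK]] [mg [L gL]]; split; first exact: measurable_funM.
exists (K * L) => t; by rewrite normrM ler_pM.
Qed.

Lemma bounded_rvN f : bounded_rv f -> bounded_rv (fun t => - f t).
Proof.
move=> [mf [K fK]]; split; first exact: measurableT_comp.
by exists K => t; rewrite normrN.
Qed.

Lemma bounded_rv_norm f : bounded_rv f -> bounded_rv (fun t => `|f t|).
Proof.
move=> [mf [K fK]]; split; first exact: measurableT_comp.
by exists K => t; rewrite normr_id.
Qed.

Lemma bounded_rv_sum (I : Type) (r : seq I) (F : I -> T -> R) :
  (forall i, bounded_rv (F i)) -> bounded_rv (fun t => \sum_(i <- r) F i t).
Proof.
move=> bF; elim: r => [|i r IH].
  by under eq_fun do rewrite big_nil; exact: bounded_rv_cst.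
by under eq_fun do rewrite big_cons; exact: bounded_rvD.
Qed.

Lemma bounded_rvX f n : bounded_rv f -> bounded_rv (fun t => f t ^+ n).
Proof.
move=> bf; elim: n => [|n IH]; first exact: bounded_rv_cst.
by under eq_fun do rewrite exprS; exact: bounded_rvM.
Qed.

Lemma bounded_rv_integrable f :
  bounded_rv f -> P.-integrable setT (EFin \o f).
Proof.
move=> [mf [K fK]]; apply: measurable_bounded_integrable => //.
  exact: le_lt_trans (probability_le1 P measurableT) (ltry _).
by exists K; split; [exact: num_real | move=> M KM t _; exact: le_trans (ltW KM)].
Qed.

Lemma EFin_mean f : bounded_rv f -> (\int[P]_t (f t)%:E)%E = (mean f)%:E.
Proof.
move=> bf; rewrite /mean /Rintegral fineK //.
exact: integrable_fin_num (bounded_rv_integrable bf).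
Qed.

Lemma meanD f g : bounded_rv f -> bounded_rv g ->
  mean (fun t => f t + g t) = mean f + mean g.
Proof. by move=> bf bg; rewrite /mean RintegralD //; exact: bounded_rv_integrable. Qed.

Lemma meanB f g : bounded_rv f -> bounded_rv g ->
  mean (fun t => f t - g t) = mean f - mean g.
Proof. by move=> bf bg; rewrite /mean RintegralB //; exact: bounded_rv_integrable. Qed.

Lemma meanZ c f : bounded_rv f -> mean (fun t => c * f t) = c * mean f.
Proof. by move=> bf; rewrite /mean RintegralZl //; exact: bounded_rv_integrable. Qed.

Lemma mean_cst c : mean (fun=> c) = c.
Proof. rewrite /mean Rintegral_cst // (_ : fine _ = 1) ?mulr1 //.
rewrite -[1]/(fine 1%E); congr fine; exact: probability_setT. Qed.

Lemma mean_sum (I : Type) (r : seq I) (F : I -> T -> R) :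
  (forall i, bounded_rv (F i)) ->
  mean (fun t => \sum_(i <- r) F i t) = \sum_(i <- r) mean (F i).
Proof.
move=> bF; elim: r => [|i r IH].
  by under [in LHS]eq_fun do rewrite big_nil; rewrite mean_cst big_nil.
under [in LHS]eq_fun do rewrite big_cons.
by rewrite meanD // ?IH ?big_cons //; exact: bounded_rv_sum.
Qed.

Lemma eq_mean f g : f =1 g -> mean f = mean g.
Proof. by move=> fg; congr mean; apply/funext. Qed.

Lemma ler_mean f g : bounded_rv f -> bounded_rv g ->
  (forall t, f t <= g t) -> mean f <= mean g.
Proof.
by move=> bf bg fg; apply: le_Rintegral => //; exact: bounded_rv_integrable.
Qed.

Lemma mean_ge0 f : (forall t, 0 <= f t) -> 0 <= mean f.
Proof. by move=> f0; apply: Rintegral_ge0. Qed.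

End BoundedExpectation.

Ltac bounded_rv :=
  repeat first
    [ done | apply: bounded_rv_cst | apply: bounded_rvD | apply: bounded_rvN
    | apply: bounded_rvM | apply: bounded_rvX | apply: bounded_rv_norm
    | apply: bounded_rv_sum => ? ].


(** * Partial sums, their normalisation and their weighted averages *)

Section WalkProcesses.
Context {R : realType} {T : Type}.
Implicit Types (a : R) (x : nat -> T -> R).

(* All three processes are indexed so that n stands for time n.+1. *)
Definition walk_sum x n t := \sum_(j < n.+1) x j t.

Definition walk_martingale a x n t := (erw_growth a n)^-1 * walk_sum x n t.

Definition walk_average a x n t :=
  (erw_mass a n)^-1 * \sum_(k < n.+1) walk_sum x k t.

End WalkProcesses.

(** Jensen's inequality for the square, from the exact decomposition of a second moment around z
    into variance plus squared bias. *)
Lemma sqr_sub_mean_le (R : realType) n (w y : 'I_n -> R) (z : R) :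
  (forall k, 0 <= w k) -> \sum_k w k = 1 ->
  (z - \sum_k w k * y k) ^+ 2 <= \sum_k w k * (z - y k) ^+ 2.
Proof.
move=> w0 w1; set m := \sum_k w k * y k.
have -> : \sum_k w k * (z - y k) ^+ 2 =
    \sum_k w k * (y k - m) ^+ 2 + (z - m) ^+ 2.
  (* Linear in the total weight and in the last [m], so that unfolding that one occurrence reduces
     the identity to a termwise one. *)
  have -> : (z - m) ^+ 2 = (z ^+ 2 - m ^+ 2) * \sum_k w k + 2 * (m - z) * m.
    by rewrite w1; ring.
  rewrite {4}/m !big_distrr -!big_split /=; apply: eq_bigr => k _; ring.
by rewrite lerDr; apply: sumr_ge0 => k _; rewrite mulr_ge0 ?sqr_ge0.
Qed.

(** * Second-moment estimates from the covariance recursion alone *)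

Section SecondMoments.
Context {R : realType} {dT : measure_display} {T : measurableType dT}.
Variables (P : probability T R) (a K : R) (x : nat -> T -> R).
Hypothesis a_half : 1 < 2 * a.
Hypothesis a_le1 : a <= 1.
Hypothesis bx : forall k, bounded_rv (x k).
Hypothesis varx : forall k, mean P (fun t => x k t ^+ 2) <= K.
Hypothesis covx : forall k n, (k <= n)%N ->
  mean P (fun t => x k t * x n.+1 t) =
  a / n.+1%:R * \sum_(j < n.+1) mean P (fun t => x k t * x j t).

Local Notation E := (mean P).
Local Notation A := (erw_growth a).
Local Notation C := (erw_mass a).
Local Notation dl := (2 * a - 1).

Local Notation S := (walk_sum x).
Local Notation M := (walk_martingale a x).
Local Notation Z := (walk_average a x).

Let a_gt0 : 0 < a. Proof. have := a_half; lra. Qed.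
Let a01 : 0 <= a <= 1. Proof. by rewrite (ltW a_gt0) a_le1. Qed.
Let dl01 : 0 < dl <= 1. Proof. by have := a_half; have := a_le1 => ? ?; apply/andP; split; lra. Qed.
Let An0 n : A n != 0. Proof. by rewrite gt_eqF // erw_growth_gt0 // ltW. Qed.
Let Cn0 n : C n != 0. Proof. by rewrite gt_eqF // erw_mass_gt0 // ltW. Qed.
Let K_ge0 : 0 <= K.
Proof. by apply: le_trans (varx 0); apply: mean_ge0 => t; exact: sqr_ge0. Qed.

Let bS n : bounded_rv (S n). Proof. by rewrite /walk_sum; bounded_rv. Qed.
Let bM n : bounded_rv (M n). Proof. by rewrite /walk_martingale; bounded_rv. Qed.
Lemma bounded_walk_average n : bounded_rv (Z n).
Proof. by rewrite /walk_average; bounded_rv. Qed.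

Let SS n t : S n.+1 t = S n t + x n.+1 t.
Proof. by rewrite /walk_sum big_ord_recr. Qed.

Lemma mean_xxS k n : (k <= n)%N ->
  E (fun t => x k t * x n.+1 t) = a / n.+1%:R * E (fun t => x k t * S n t).
Proof.
move=> kn; rewrite covx //; congr (_ * _).
under [in RHS]eq_mean => t do rewrite /walk_sum big_distrr.
by rewrite /= mean_sum // => j; bounded_rv.
Qed.

(** The factor 1 + a / (n + 1) gained by E[x_k S_n] is exactly the one gained by the normaliser.
    This substitutes for the martingale property, tested only against past steps. *)
Lemma mean_xM k n : (k <= n)%N ->
  E (fun t => x k t * M n.+1 t) = E (fun t => x k t * M n t).
Proof.
move=> kn.
have EM m : E (fun t => x k t * M m t) = (A m)^-1 * E (fun t => x k t * S m t).
  rewrite -meanZ; last by bounded_rv.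
  by apply: eq_mean => t; rewrite /walk_martingale mulrCA.
rewrite !EM; under eq_mean => t do rewrite SS mulrDr.
rewrite meanD; [|by bounded_rv..].
rewrite mean_xxS // -[X in X + _]mul1r -mulrDl mulrA; congr (_ * _).
rewrite erw_growthS invfM -mulrA mulVf ?mulr1 //.
by rewrite gt_eqF // ltr_wpDr // divr_ge0 // ltW.
Qed.

Lemma mean_xM_stable k n m : (k <= n)%N -> (n <= m)%N ->
  E (fun t => x k t * M m t) = E (fun t => x k t * M n t).
Proof.
move=> kn; elim: m => [|m IH]; first by rewrite leqn0 => /eqP ->.
rewrite leq_eqVlt => /predU1P[->//|nm].
by rewrite mean_xM ?IH // (leq_trans kn).
Qed.

(** M_k is a linear combination of steps up to index k, and the correlation of each of them with M
    is frozen from index k on. *)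
Lemma mean_MM k n : (k <= n)%N ->
  E (fun t => M k t * M n t) = E (fun t => M k t ^+ 2).
Proof.
move=> kn.
have EM m : E (fun t => M k t * M m t) =
    (A k)^-1 * \sum_(j < k.+1) E (fun t => x j t * M m t).
  rewrite -mean_sum; last by move=> j; bounded_rv.
  rewrite -meanZ; last by bounded_rv.
  by apply: eq_mean => t; rewrite {1}/walk_martingale -mulrA; congr (_ * _); rewrite /walk_sum big_distrl.
under [RHS]eq_mean => t do rewrite expr2.
rewrite !EM; congr (_ * _); apply: eq_bigr => j _.
by apply: mean_xM_stable => //; rewrite -ltnS.
Qed.

Lemma mean_MB k n : (k <= n)%N ->
  E (fun t => (M n t - M k t) ^+ 2) =
  E (fun t => M n t ^+ 2) - E (fun t => M k t ^+ 2).
Proof.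
move=> kn.
have -> : E (fun t => (M n t - M k t) ^+ 2) =
    E (fun t => (M n t ^+ 2 + M k t ^+ 2) - 2 * (M k t * M n t)).
  by apply: eq_mean => t; ring.
rewrite meanB ?meanD ?meanZ ?mean_MM; [ring|by bounded_rv..].
Qed.

Lemma mean_MS n :
  E (fun t => M n.+1 t ^+ 2) <= E (fun t => M n t ^+ 2) + K * n.+2%:R `^ (- dl - 1).
Proof.
have EM m : E (fun t => M m t ^+ 2) = (A m ^+ 2)^-1 * E (fun t => S m t ^+ 2).
  rewrite -meanZ; last by bounded_rv.
  by apply: eq_mean => t; rewrite /walk_martingale exprMn exprVn.
have ES : E (fun t => S n.+1 t ^+ 2) =
    (1 + 2 * (a / n.+1%:R)) * E (fun t => S n t ^+ 2) + E (fun t => x n.+1 t ^+ 2).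
  have -> : E (fun t => S n.+1 t ^+ 2) =
      E (fun t => (S n t ^+ 2 + 2 * (S n t * x n.+1 t)) + x n.+1 t ^+ 2).
    by apply: eq_mean => t; rewrite SS; ring.
  rewrite meanD ?meanD ?meanZ; [|by bounded_rv..].
  have -> : E (fun t => S n t * x n.+1 t) = a / n.+1%:R * E (fun t => S n t ^+ 2).
    under eq_mean => t do rewrite /walk_sum big_distrl /=.
    rewrite mean_sum; last by move=> j; bounded_rv.
    rewrite (eq_bigr _ (fun j _ => mean_xxS (leq_ord j))) -big_distrr /=; congr (_ * _).
    rewrite -mean_sum; last by move=> j; bounded_rv.
    by apply: eq_mean => t; rewrite expr2 {2}/walk_sum big_distrl.
  by ring.
rewrite !EM ES mulrDr; apply: lerD.
  (* With u = a / (n + 1), the second moment of the sum is multiplied by 1 + 2u, at most the factor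
     (1 + u)^2 gained by the squared normaliser. *)
  rewrite [leLHS]mulrA ler_wpM2r //; first by apply: mean_ge0 => t; exact: sqr_ge0.
  rewrite mulrC ler_pdivrMr ?exprn_gt0 ?erw_growth_gt0 ?(ltW a_gt0) //.
  rewrite erw_growthS exprMn mulKf ?sqrf_eq0 //.
  by rewrite -subr_ge0 (_ : _ - _ = (a / n.+1%:R) ^+ 2) ?sqr_ge0 //; ring.
rewrite mulrC; apply: ler_pM => //.
- by apply: mean_ge0 => t; exact: sqr_ge0.
- by rewrite invr_ge0 sqr_ge0.
(* The new step contributes at most K over the squared normaliser, which is at least (n +
   2)^(2a). *)
have -> : - dl - 1 = - (a + a) by ring.
rewrite powRN lef_pV2 ?posrE ?exprn_gt0 ?erw_growth_gt0 ?(ltW a_gt0) ?powR_gt0 //.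
rewrite powRD ?pnatr_eq0 ?implybT // -expr2.
rewrite lerXn2r ?nnegrE ?powR_ge0 ?erw_growth_ge //.
exact: ltW (erw_growth_gt0 _ (ltW a_gt0)).
Qed.

(** By orthogonality the increments add up, and the tail of the sum of j^(-2a) is of order k^(1 -
    2a). *)
Lemma mean_MB_le k n : (k <= n)%N ->
  E (fun t => (M n t - M k t) ^+ 2) <= K / dl * k.+1%:R `^ (- dl).
Proof.
move=> kn; rewrite mean_MB //.
apply: (@le_trans _ _ (K * \sum_(k <= j < n) j.+2%:R `^ (- dl - 1))); last first.
  by rewrite -mulrA ler_wpM2l // sum_powRN_le.
elim: n kn => [|n IH]; first by rewrite leqn0 => /eqP ->; rewrite subrr big_geq ?mulr0.
rewrite leq_eqVlt => /predU1P[->|kn]; first by rewrite subrr big_geq ?mulr0.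
rewrite big_nat_recr //= mulrDr.
by have := IH kn; have := mean_MS n; lra.
Qed.

(** Exhibits Z_n as a convex combination of M_0, ..., M_n, ready for Jensen. *)
Lemma walk_averageE n t :
  Z n t = \sum_(k < n.+1) A k / C n * M k t.
Proof.
rewrite /walk_average big_distrr /=; apply: eq_bigr => k _.
by rewrite /walk_martingale mulrAC mulrA divff // mul1r mulrC.
Qed.

Lemma erw_mass_ge n : n.+1%:R * n.+1%:R `^ a <= 2 * C n.
Proof.
apply: (@le_trans _ _ ((1 + a) * C n)).
  rewrite erw_massE ler_pM ?powR_ge0 ?erw_growth_ge //.
  by rewrite lerDl ltW.
rewrite ler_wpM2r //; first exact: ltW (erw_mass_gt0 _ (ltW a_gt0)).
by have := a_le1; lra.
Qed.

(** The factor 2 comes from the lower bound on the mass, (a^a)^-1 from the upper bound on the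
    growth, and K / dl from the L^2 rate of M. *)
Local Notation K2 := (2 * (a `^ a)^-1 * (K / dl)).

(** After Jensen, the k-th term is of order k^a k^(1 - 2a) = k^(1 - a) over the mass. Since a <= 1
    this is largest at k = n, so n + 1 copies of the last term suffice. *)
Lemma mean_MZ n : E (fun t => (M n t - Z n t) ^+ 2) <= K2 * n.+1%:R `^ (- dl).
Proof.
have bZ := bounded_walk_average.
have dl0 : 0 < dl by case/andP: dl01.
have Kd0 : 0 <= K / dl by rewrite divr_ge0 // ltW.
have C0 : 0 < C n by rewrite erw_mass_gt0 // ltW.
have w0 k : 0 <= A k / C n by rewrite ltW // divr_gt0 // erw_growth_gt0 // ltW.
apply: (@le_trans _ _ (E (fun t => \sum_(k < n.+1) A k / C n * (M n t - M k t) ^+ 2))).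
  apply: ler_mean; [by bounded_rv..|].
  move=> t; rewrite walk_averageE; apply: sqr_sub_mean_le => //.
  by rewrite -big_distrl; exact: divff (Cn0 n).
rewrite mean_sum; last by move=> k; bounded_rv.
apply: (@le_trans _ _ (\sum_(k < n.+1) (a `^ a)^-1 * (K / dl) * n.+1%:R `^ (1 - a) / C n)).
  apply: ler_sum => k _; rewrite meanZ; last by bounded_rv.
  apply: (le_trans (ler_wpM2l (w0 k) (mean_MB_le (leq_ord k)))).
  have -> : A k / C n * (K / dl * k.+1%:R `^ (- dl)) =
      K / dl * (A k * k.+1%:R `^ (- dl)) / C n by ring.
  have -> : (a `^ a)^-1 * (K / dl) * n.+1%:R `^ (1 - a) / C n =
      K / dl * ((a `^ a)^-1 * n.+1%:R `^ (1 - a)) / C n by ring.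
  rewrite ler_pM2r ?invr_gt0 // ler_wpM2l //.
  apply: (@le_trans _ _ ((a `^ a)^-1 * k.+1%:R `^ a * k.+1%:R `^ (- dl))).
    by rewrite ler_wpM2r ?powR_ge0 // erw_growth_le // a_gt0.
  rewrite -mulrA ler_wpM2l ?invr_ge0 ?powR_ge0 //.
  rewrite -powRD ?pnatr_eq0 ?implybT //.
  have -> : a + - dl = 1 - a by ring.
  by rewrite ge0_ler_powR ?nnegrE ?subr_ge0 // ler_nat.
rewrite sumr_const card_ord -[_ *+ n.+1]mulr_natl.
have -> : n.+1%:R `^ (- dl) = n.+1%:R `^ (1 - a) / n.+1%:R `^ a.
  by rewrite -powRN -powRD ?pnatr_eq0 ?implybT //; congr (_ `^ _); ring.
set q := n.+1%:R `^ (1 - a); set c := (a `^ a)^-1 * (K / dl).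
have q0 : 0 <= c * q by rewrite mulr_ge0 ?powR_ge0 // mulr_ge0 ?invr_ge0 ?powR_ge0.
have -> : n.+1%:R * (c * q / C n) = c * q * (n.+1%:R / C n) by ring.
have -> : K2 * (q / n.+1%:R `^ a) = c * q * (2 / n.+1%:R `^ a) by rewrite /c; ring.
rewrite ler_wpM2l // ler_pdivrMr // mulrAC ler_pdivlMr ?powR_gt0 ?ltr0n //.
exact: erw_mass_ge.
Qed.

(** Z_(n+1) averages Z_n and M_(n+1) with weights proportional to C_n and A_(n+1), and A_(n+1) / C_n
    = (1 + a) / (n + 1) by the closed form of the mass. *)
Lemma walk_average_incr n t :
  Z n.+1 t - Z n t = (1 + a) / n.+1%:R * (M n.+1 t - Z n.+1 t).
Proof.
rewrite /walk_martingale /walk_average big_ord_recr /= erw_massS.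
have n0 : n.+1%:R != 0 :> R by rewrite pnatr_eq0.
have -> : A n.+1 = (1 + a) / n.+1%:R * C n.
  by rewrite mulrAC erw_massE_growthS mulrAC divff // mul1r.
have a1 : 1 + a != 0 by rewrite gt_eqF // ltr_wpDr // ltW.
have na : n.+1%:R + (1 + a) != 0 by rewrite gt_eqF // !addr_gt0.
move: (\sum_(_ < _) _) (S n.+1 t) (C n) (Cn0 n) n.+1%:R n0 na => B s c c0 m m0 ma.
by field; rewrite m0 a1 c0 andbT [_ * c]mulrC -mulrDr mulf_neq0.
Qed.

Lemma mean_norm_incr n :
  E (fun t => `|Z n.+1 t - Z n t|) <= 2 * (K2 + 1) * n.+2%:R `^ (- (dl / 2) - 1).
Proof.
have bZ := bounded_walk_average.
set m : R := n.+2%:R.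
have m0 : 0 < m by rewrite ltr0n.
have n0 : 0 < n.+1%:R :> R by rewrite ltr0n.
(* Instead of Cauchy-Schwarz, 2|y| <= q y^2 + 1 / q is used; since E[y^2] is of order m^(-dl), this
   q balances the two terms. *)
set q := m `^ (dl / 2).
have q0 : 0 < q by rewrite powR_gt0.
have qq : m `^ (- dl) = (q * q)^-1.
  by rewrite powRN /q -powRD ?(gt_eqF m0) ?implybT //; congr (_ `^ _)^-1; field.
have -> : m `^ (- (dl / 2) - 1) = q^-1 / m.
  by rewrite powRD ?(gt_eqF m0) ?implybT // powR_inv1 ?(ltW m0) // powRN.
apply: (@le_trans _ _ (E (fun t => 2 / m * (q * (M n.+1 t - Z n.+1 t) ^+ 2 + q^-1)))).
  apply: ler_mean; [by bounded_rv..|move=> t].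
  rewrite walk_average_incr normrM.
  (* Here 1 + a <= 2 and n + 2 <= 2 (n + 1). *)
  apply: (@le_trans _ _ (4 / m * `|M n.+1 t - Z n.+1 t|)).
    rewrite ler_wpM2r // ger0_norm; last by rewrite divr_ge0 ?addr_ge0 ?ltW.
    rewrite ler_pdivrMr // mulrAC ler_pdivlMr // /m -(natr1 n.+1).
    have n1 : (1 : R) <= n.+1%:R by rewrite ler1n.
        apply: (@le_trans _ _ (2 * (n.+1%:R + 1))); last lra.
    by rewrite ler_wpM2r ?addr_ge0 //; have := a_le1; lra.
  move: (M n.+1 t - Z n.+1 t) => y.
  have -> : 4 / m * `|y| = 2 / m * (2 * `|y|) by ring.
  rewrite ler_wpM2l ?divr_ge0 ?(ltW m0) // -[y ^+ 2]real_normK ?num_real //.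
  have := sqr_ge0 (q * `|y| - 1); move: `|y| => z h.
  have -> : q * z ^+ 2 + q^-1 = (q ^+ 2 * z ^+ 2 + 1) / q.
    by field; rewrite gt_eqF.
  by rewrite ler_pdivlMr //; nra.
rewrite meanZ ?meanD ?meanZ ?mean_cst; [|by bounded_rv..].
have := mean_MZ n.+1; rewrite -/m qq => /(ler_wpM2l (ltW q0)).
move: K2 => k h.
have -> : 2 * (k + 1) * (q^-1 / m) = 2 / m * (q * (k * (q * q)^-1) + q^-1).
  by field; rewrite !gt_eqF.
by rewrite ler_wpM2l ?divr_ge0 ?(ltW m0) // lerD2r.
Qed.

Lemma sum_mean_norm_incr :
  exists L, forall N, \sum_(n < N) E (fun t => `|Z n.+1 t - Z n t|) <= L.
Proof.
have hd : 0 < dl / 2 <= 1 by have := dl01 => /andP[? ?]; apply/andP; split; lra.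
have dl0 : 0 < dl by case/andP: dl01.
have K20 : 0 <= K2 by rewrite !mulr_ge0 ?invr_ge0 ?powR_ge0 ?K_ge0 ?(ltW dl0).
(* The tail bound [sum_powRN_le] started at index 0, with exponent s = dl / 2. *)
exists (2 * (K2 + 1) * ((dl / 2)^-1 * 1%:R `^ (- (dl / 2)))) => N.
apply: (@le_trans _ _ (\sum_(n < N) 2 * (K2 + 1) * n.+2%:R `^ (- (dl / 2) - 1))).
  by apply: ler_sum => n _; exact: mean_norm_incr.
rewrite -big_distrr /= ler_wpM2l //; first by rewrite mulr_ge0 // addr_ge0.
by rewrite -(big_mkord xpredT (fun n => n.+2%:R `^ (- (dl / 2) - 1))) sum_powRN_le.
Qed.

Lemma mean_walk_averageB :
  exists L, forall n m, (n <= m)%N ->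
    E (fun t => (Z n t - Z m t) ^+ 2) <= L * n.+1%:R `^ (- dl).
Proof.
have bZ := bounded_walk_average.
have dl0 : 0 < dl by case/andP: dl01.
have K20 : 0 <= K2 by rewrite !mulr_ge0 ?invr_ge0 ?powR_ge0 ?K_ge0 ?(ltW dl0).
exists (3 * (K2 + K / dl + K2)) => n m nm.
apply: (@le_trans _ _ (E (fun t => 3 * ((M n t - Z n t) ^+ 2 +
    (M m t - M n t) ^+ 2 + (M m t - Z m t) ^+ 2)))).
  apply: ler_mean; [by bounded_rv..|move=> t].
  move: (M n t) (Z n t) (M m t) (Z m t) => u v w z.
  (* The difference Z_n - Z_m passes through M_n and M_m; the defect in the inequality between the
     square of a three-term sum and three times the sum of squares is itself a sum of squares. *)
  rewrite -subr_ge0 (_ : _ - _ = ((u - v) + (w - z)) ^+ 2 +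
    ((u - v) - (w - u)) ^+ 2 + ((w - u) + (w - z)) ^+ 2); last ring.
  by rewrite !addr_ge0 ?sqr_ge0.
rewrite meanZ ?meanD; [|by bounded_rv..].
rewrite -[leRHS]mulrA ler_wpM2l // [leRHS]mulrDl; apply: lerD.
  by rewrite [leRHS]mulrDl; apply: lerD; [exact: mean_MZ | exact: mean_MB_le].
apply: (le_trans (mean_MZ m)); rewrite ler_wpM2l // !powRN.
rewrite lef_pV2 ?posrE ?powR_gt0 ?ltr0n //.
by rewrite ge0_ler_powR ?nnegrE ?(ltW dl0) // ler_nat.
Qed.

(* The averages keep a fixed correlation with the first step: E[Z_n x_0] = E[x_0 ^ 2]. *)
Lemma mean_walk_average_var n (c : R) : E (x 0) = 0 ->
  E (fun t => x 0 t ^+ 2) <= E (fun t => (Z n t - c) ^+ 2).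
Proof.
move=> Ex0; have bZ := bounded_walk_average.
have EZ : E (fun t => x 0 t * Z n t) = E (fun t => x 0 t ^+ 2).
  under eq_mean => t do rewrite walk_averageE big_distrr /=.
  rewrite mean_sum; last by move=> k; bounded_rv.
  have h (k : 'I_n.+1) : E (fun t => x 0 t * (A k / C n * M k t)) =
      A k / C n * E (fun t => x 0 t ^+ 2).
    under eq_mean => t do rewrite mulrCA.
    rewrite meanZ; last by bounded_rv.
    (* The correlation is frozen from index 0, where M_0 = x_0 because the product A_0 is empty. *)
    rewrite (@mean_xM_stable 0 0) //; congr (_ * _); apply: eq_mean => t.
    by rewrite /walk_martingale /walk_sum big_ord1 /erw_growth big_ord0 invr1 mul1r.
  by rewrite (eq_bigr _ (fun k _ => h k)) -!big_distrl /= (_ : _ / _ = 1) ?mul1r //;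
     exact: divff (Cn0 n).
(* The mean of (Z_n - c - x_0)^2 >= 0, expanded; its left side equals 2 E[x_0^2]. *)
have : E (fun t => 2 * (x 0 t * Z n t) - 2 * c * x 0 t) <=
       E (fun t => (Z n t - c) ^+ 2 + x 0 t ^+ 2).
  apply: ler_mean; [by bounded_rv..|move=> t].
  rewrite -subr_ge0 (_ : _ - _ = (Z n t - c - x 0 t) ^+ 2) ?sqr_ge0 //; ring.
rewrite meanB ?meanD ?meanZ; [|by bounded_rv..].
rewrite EZ Ex0; lra.
Qed.

End SecondMoments.

(** * Almost sure and L^2 convergence from summable increments *)

Section FastCauchy.
Context {R : realType} {dT : measure_display} {T : measurableType dT}.
Variables (P : probability T R) (Z : nat -> T -> R) (L : R) (r : nat -> R).
Hypothesis bZ : forall n, bounded_rv (Z n).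
Hypothesis L1Z : forall N, \sum_(n < N) mean P (fun t => `|Z n.+1 t - Z n t|) <= L.
Hypothesis L2Z : forall n m, (n <= m)%N ->
  mean P (fun t => (Z n t - Z m t) ^+ 2) <= r n.

(** The sum of the absolute increments has finite expectation, hence is almost surely finite, and
    the telescoping series converges absolutely. *)
Lemma summable_incr_cvg_ae :
  {ae P, forall t, cvgn (fun n => Z n t)}.
Proof.
pose F t : \bar R := (\sum_(0 <= n <oo) (`|Z n.+1 t - Z n t|)%:E)%E.
have bI n : bounded_rv (fun t => `|Z n.+1 t - Z n t|) by bounded_rv.
have mI n : measurable_fun setT (fun t => (`|Z n.+1 t - Z n t|)%:E).
  by apply/measurable_EFinP; case: (bI n).
have F0 t : (0 <= F t)%E by apply: nneseries_ge0.
have iF : P.-integrable setT F.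
  apply/integrableP; split.
    by apply: ge0_emeasurable_sum => // n t _ _; rewrite lee_fin.
  rewrite (eq_integral F); last by move=> t _; rewrite gee0_abs //.
  rewrite /F integral_nneseries //.
  apply: (@le_lt_trans _ _ L%:E); last exact: ltry.
  apply: lime_le; first by apply: is_cvg_nneseries => n _ _; apply: integral_ge0.
  apply: nearW => N; rewrite big_mkord.
  rewrite (eq_bigr (fun n : 'I_N => (mean P (fun t => `|Z n.+1 t - Z n t|))%:E)); last first.
    by move=> n _; rewrite EFin_mean.
  by rewrite sumEFin lee_fin; exact: L1Z.
apply: filterS (integrable_ae measurableT iF) => t /(_ I) Ft.
have cs : cvgn (series (telescope (Z^~ t))).
  apply: normed_cvg; apply: nnseries_is_cvg => [n|]; first exact: normr_ge0.
  by move/fin_numPlt : Ft => /andP[].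
have -> : (fun n => Z n t) = (fun n => Z 0 t + series (telescope (Z^~ t)) n).
  by apply/funext => n; rewrite -(eq_sum_telescope (Z^~ t) n).
by apply: is_cvgD => //; exact: is_cvg_cst.
Qed.

Lemma fast_cauchy_cvg : exists Y : T -> R,
  [/\ measurable_fun setT Y,
      {ae P, forall t, ((fun n => Z n t) @ \oo --> Y t)%classic} &
      forall n, (\int[P]_t ((Z n t - Y t) ^+ 2)%:E <= (r n)%:E)%E].
Proof.
(* An upper limit is measurable on the whole space; infinite values, sent to 0 by [fine], occur only
   on a null set. *)
pose Y t := fine (limn_esup (fun n => (Z n t)%:E)).
have mY : measurable_fun setT Y.
  apply: measurableT_comp; first exact: fine_measurable.
  apply: measurable_fun_limn_esup => n; apply/measurable_EFinP.
  by case: (bZ n).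
have cY : {ae P, forall t, ((fun n => Z n t) @ \oo --> Y t)%classic}.
  apply: filterS summable_incr_cvg_ae => t /cvg_ex[l Zl].
  have : (((fun n => (Z n t)%:E) @ \oo) --> l%:E)%classic by apply: cvg_EFin => //; exact: nearW.
  by rewrite /Y => /cvg_limn_einf_sup[_ ->].
exists Y; split => // n.
(* The shift by [n] keeps the second index at least [n], as [L2Z] requires. *)
pose f m t : \bar R := ((Z n t - Z (m + n)%N t) ^+ 2)%:E.
have bf m : bounded_rv (fun t => (Z n t - Z (m + n)%N t) ^+ 2) by bounded_rv.
have mf m : measurable_fun setT (f m) by apply/measurable_EFinP; case: (bf m).
have mg : measurable_fun setT (fun t => ((Z n t - Y t) ^+ 2)%:E).
  apply/measurable_EFinP; apply: (measurable_funX 2).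
  by apply: measurable_funB => //; case: (bZ n).
(* Almost everywhere the integrand is the limit, hence the lower limit, of [f]; this is the form to
   which Fatou applies. *)
have -> : (\int[P]_t ((Z n t - Y t) ^+ 2)%:E = \int[P]_t limn_einf (f^~ t))%E.
  apply: ae_eq_integral => //; first apply: measurableT_comp => //.
    by apply: (@measurable_fun_limn_esup _ _ _ _ (fun m t => - f m t)%E) => m;
       exact: measurableT_comp.
  apply: filterS cY => t cZ _.
  have : (((fun m => f m t) @ \oo) --> ((Z n t - Y t) ^+ 2)%:E)%classic.
    apply: cvg_EFin; first exact: nearW.
    have cB : ((fun m => Z n t - Z (m + n)%N t) @ \oo --> Z n t - Y t)%classic.
      apply: cvgB; first exact: cvg_cst.
      by rewrite (cvg_shiftn n (Z^~ t)).
    exact: (cvgM cB cB).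
  by move=> /cvg_limn_einf_sup[-> _].
apply: (le_trans (fatou P measurableT mf _)).
  by move=> m t _; rewrite lee_fin sqr_ge0.
(* Each tail infimum is at most its first term, whose integral is at most [r n]. *)
rewrite limn_einf_lim; apply: lime_le; first exact: is_cvg_einfs.
apply: nearW => m.
apply: (@le_trans _ _ (\int[P]_t f m t)%E).
  by apply: ereal_inf_lbound; exists m => /=.
by rewrite EFin_mean // lee_fin L2Z // leq_addl.
Qed.

End FastCauchy.

Lemma cvg_powRN (R : realType) (s : R) : 0 < s ->
  ((fun n => n.+1%:R `^ (- s)) @ \oo --> (0 : R))%classic.
Proof.
move=> s0.
have -> : (fun n => n.+1%:R `^ (- s)) = (fun y : R => y `^ s) \o (@harmonic R).
  apply/funext => n /=; rewrite powRN /harmonic /=.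
  apply: (mulfI (_ : n.+1%:R `^ s != 0)); first by rewrite gt_eqF // powR_gt0 // ltr0n.
  rewrite divff ?gt_eqF ?powR_gt0 ?ltr0n // -powRM ?invr_ge0 //.
  by rewrite divff ?pnatr_eq0 // powR1.
(* The power tends to 0 along the right neighbourhood of 0, which the positive harmonic sequence
   enters. *)
apply: (@cvg_comp _ _ _ _ _ _ (0^'+)%classic); last exact: powR_cvg0.
move=> A; rewrite /at_right /within /= => h.
have hA : (\forall n \near \oo, 0 < @harmonic R n -> A (harmonic n))%classic.
  exact: (@cvg_harmonic R _ h).
by apply: (filterS _ hA) => n; apply; exact: harmonic_gt0.
Qed.

(** * Limit of the rescaled barycentre of a real process *)

Section ScalarLimit.
Context {R : realType} {dT : measure_display} {T : measurableType dT}.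
Variables (P : probability T R) (a K : R) (x : nat -> T -> R).
Hypothesis a_half : 1 < 2 * a.
Hypothesis a_le1 : a <= 1.
Hypothesis bx : forall k, bounded_rv (x k).
Hypothesis varx : forall k, mean P (fun t => x k t ^+ 2) <= K.
Hypothesis covx : forall k n, (k <= n)%N ->
  mean P (fun t => x k t * x n.+1 t) =
  a / n.+1%:R * \sum_(j < n.+1) mean P (fun t => x k t * x j t).
Hypothesis mean_x0 : mean P (x 0) = 0.
Hypothesis var_x0 : 0 < mean P (fun t => x 0 t ^+ 2).

Local Notation Z := (walk_average a x).
Local Notation dl := (2 * a - 1).

(* The j-th step of the walk (j >= 1) is x_(j-1). *)
Definition scaled_barycentre n t : R :=
  (n%:R `^ a)^-1 * (n%:R^-1 * \sum_(1 <= k < n.+1) \sum_(1 <= j < k.+1) x j.-1 t).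

(** Separates a deterministic factor, convergent by [cvg_erw_mass], from the random average. *)
Lemma scaled_barycentreS n t : scaled_barycentre n.+1 t =
  erw_mass a n / (n.+1%:R * n.+1%:R `^ a) * Z n t.
Proof.
rewrite /scaled_barycentre /walk_average big_add1 big_mkord.
have a0 : 0 <= a by have := a_half; have := a_le1; lra.
have C0 : erw_mass a n != 0 by rewrite gt_eqF // erw_mass_gt0.
rewrite (_ : \sum_(k < n.+1) _ = \sum_(k < n.+1) walk_sum x k t); last first.
  by apply: eq_bigr => k _; rewrite big_add1 big_mkord.
rewrite [LHS]mulrA [RHS]mulrA; congr (_ * _).
by rewrite mulrAC mulfV // mul1r invfM mulrC.
Qed.

(** Controls the error made when the deterministic factor is replaced by its limit. *)
Lemma mean_walk_average_bounded : exists B, forall n, mean P (fun t => Z n t ^+ 2) <= B.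
Proof.
have bZ := bounded_walk_average a bx.
have [L hL] := mean_walk_averageB a_half a_le1 bx varx covx.
exists (2 * L + 2 * mean P (fun t => Z 0 t ^+ 2)) => n.
apply: (@le_trans _ _ (mean P (fun t => 2 * (Z 0 t - Z n t) ^+ 2 + 2 * Z 0 t ^+ 2))).
  apply: ler_mean; [by bounded_rv..|move=> t].
  rewrite -subr_ge0 (_ : _ - _ = (2 * Z 0 t - Z n t) ^+ 2) ?sqr_ge0 //; ring.
rewrite meanD ?meanZ; [|by bounded_rv..].
by rewrite lerD2r ler_wpM2l //; have := hL 0 n (leq0n n); rewrite powR1 mulr1.
Qed.

Lemma scaled_barycentre_cvg : exists W : T -> R,
  [/\ measurable_fun setT W,
      forall c, (P [set t | W t = c]%classic < 1%:E)%E,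
      {ae P, forall t, ((fun n => scaled_barycentre n t) @ \oo --> W t)%classic} &
      ((fun n => \int[P]_t ((scaled_barycentre n t - W t) ^+ 2)%:E)%E @ \oo
         --> 0%:E)%classic].
Proof.
have bZ := bounded_walk_average a bx.
have a0 : 0 < a by have := a_half; have := a_le1; lra.
have dl0 : 0 < dl by have := a_half; lra.
have [L hL] := mean_walk_averageB a_half a_le1 bx varx covx.
have [L1 hL1] := sum_mean_norm_incr a_half a_le1 bx varx covx.
have [Y [mY cY iY]] := fast_cauchy_cvg bZ hL1 hL.
have [g g0 cg] : exists2 g : R, 0 < g &
    ((fun n => erw_mass a n / (n.+1%:R * n.+1%:R `^ a)) @ \oo --> g)%classic.
  by apply: cvg_erw_mass; rewrite a0.
set gn := (fun n : nat => _) in cg.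
have [B hB] := mean_walk_average_bounded.
have cr : ((fun n => L * n.+1%:R `^ (- dl)) @ \oo --> (0 : R))%classic.
  rewrite -[X in (_ --> X)%classic](mulr0 L); apply: cvgM; first exact: cvg_cst.
  exact: cvg_powRN.
have mZY n : measurable_fun setT (fun t => ((Z n t - Y t) ^+ 2)%:E).
  apply/measurable_EFinP; apply: (measurable_funX 2).
  by apply: measurable_funB => //; case: (bZ n).
exists (fun t => g * Y t); split.
- by apply: measurable_funM.
(* If g Y = c almost surely, then E[x_0^2] <= E[(Z_n - c / g)^2] = E[(Z_n - Y)^2], which tends to 0
   and contradicts [var_x0]. *)
- move=> c; rewrite ltNge; apply/negP => h.
  have mc : measurable [set t | g * Y t = c]%classic.
    have mgY : measurable_fun setT (fun t => g * Y t) by apply: measurable_funM.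
    by have := mgY measurableT [set c]%classic (measurable_set1 c); rewrite setTI.
  have Yc : {ae P, forall t, Y t = g^-1 * c}.
    exists (~` [set t | g * Y t = c])%classic; split.
    + exact: measurableC.
    + rewrite probability_setC // (_ : P _ = 1%:E) ?subee //.
      by apply/eqP; rewrite eq_le h probability_le1.
    + move=> t /= Yt gY; apply: Yt; rewrite -gY mulKf // gt_eqF //.
  have hv n : mean P (fun t => x 0 t ^+ 2) <= L * n.+1%:R `^ (- dl).
    apply: (le_trans (mean_walk_average_var a_half bx covx n (g^-1 * c) mean_x0)).
    rewrite -lee_fin -EFin_mean; last by bounded_rv.
    apply: le_trans (iY n); rewrite le_eqVlt; apply/orP; left; apply/eqP.
    apply: ae_eq_integral => //.
      have : bounded_rv (fun t => (Z n t - g^-1 * c) ^+ 2) by bounded_rv.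
      by case=> ? _; apply/measurable_EFinP.
    by apply: filterS Yc => t -> _.
  have : mean P (fun t => x 0 t ^+ 2) <= 0.
    rewrite -(cvg_lim _ cr) //; apply: limr_ge; first by apply/cvg_ex; exists 0.
    exact: nearW.
  by rewrite leNgt var_x0.
- apply: filterS cY => t cZ; rewrite -cvg_shiftS /=.
  under eq_fun do rewrite scaled_barycentreS.
  exact: (cvgM cg cZ).
- rewrite -cvg_shiftS.
  (* The error is (g_n - g) Z_n + g (Z_n - Y); the square of a sum is at most twice the sum of
     squares, and E[Z_n^2] <= B. *)
  pose h n := (2 * (gn n - g) ^+ 2 * B + 2 * g ^+ 2 * (L * n.+1%:R `^ (- dl)))%:E.
  pose G n : \bar R := (\int[P]_t ((scaled_barycentre n.+1 t - g * Y t) ^+ 2)%:E)%E.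
  have sq n : (cst 0%:E n <= G n <= h n)%E.
    apply/andP; split.
      by apply: integral_ge0 => t _; rewrite lee_fin sqr_ge0.
    have bZ2 : bounded_rv (fun t => Z n t ^+ 2) by bounded_rv.
    apply: (@le_trans _ _ (\int[P]_t ((2 * (gn n - g) ^+ 2)%:E * (Z n t ^+ 2)%:E +
        (2 * g ^+ 2)%:E * ((Z n t - Y t) ^+ 2)%:E))%E).
      apply: ge0_le_integral => //.
      * by move=> t _; rewrite lee_fin sqr_ge0.
      * apply/measurable_EFinP; apply: (measurable_funX 2); apply: measurable_funB.
          rewrite [X in measurable_fun _ X](_ : _ = (fun t => gn n * Z n t)); last first.
            by apply/funext => t; exact: scaled_barycentreS.
          by apply: measurable_funM => //; case: (bZ n).
        by apply: measurable_funM.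
      * apply: emeasurable_funD; apply: measurable_funeM => //.
        by apply/measurable_EFinP; case: bZ2.
      * move=> t _; rewrite -!EFinM -EFinD lee_fin scaled_barycentreS -/(gn n).
        rewrite -subr_ge0 (_ : _ - _ = ((gn n - g) * Z n t - g * (Z n t - Y t)) ^+ 2) ?sqr_ge0 //.
        by ring.
    rewrite ge0_integralD //; last 4 first.
    * by move=> t _; rewrite -EFinM lee_fin mulr_ge0 ?sqr_ge0 // mulr_ge0 ?sqr_ge0.
    * by apply: measurable_funeM; apply/measurable_EFinP; case: bZ2.
    * by move=> t _; rewrite -EFinM lee_fin mulr_ge0 ?sqr_ge0 // mulr_ge0 ?sqr_ge0.
    * exact: measurable_funeM.
    have mZ2 : measurable_fun setT (fun t => (Z n t ^+ 2)%:E).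
      by apply/measurable_EFinP; case: bZ2.
    have c0 (c : R) : (0 <= (2 * c ^+ 2)%:E)%E by rewrite lee_fin mulr_ge0 ?sqr_ge0.
    have sq0 (c : R) : (0 <= (c ^+ 2)%:E)%E by rewrite lee_fin sqr_ge0.
    rewrite (ge0_integralZl _ _ mZ2) // (ge0_integralZl _ _ (mZY n)) //.
    rewrite (EFin_mean P bZ2) /h EFinD; apply: leeD.
      by rewrite -EFinM lee_fin ler_wpM2l // mulr_ge0 ?sqr_ge0.
    by rewrite [leRHS]EFinM lee_wpmul2l.
  have sqn : (\forall n \near \oo, (cst 0%:E n <= G n <= h n)%E)%classic by exact: nearW.
  suff ch : (h @ \oo --> 0%:E)%classic.
    have cG : (G @ \oo --> 0%:E)%classic.
      by apply: (squeeze_cvge sqn) => //; exact: cvg_cst.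
    exact: cG.
  apply: cvg_EFin; first exact: nearW.
  have cB : ((fun n => gn n - g) @ \oo --> (0 : R))%classic.
    by rewrite -(subrr g); apply: cvgB => //; exact: cvg_cst.
  rewrite -[X in (_ --> X)%classic](_ : 2 * (0 * 0) * B + 2 * g ^+ 2 * 0 = 0); last by ring.
  apply: cvgD; apply: cvgM; [|exact: cvg_cst|exact: cvg_cst|exact: cr].
  apply: cvgM; [exact: cvg_cst|exact: (cvgM cB cB)].
Qed.

End ScalarLimit.

(** * Random variables with values in a finite type *)

Section FiniteValued.
Context {R : realType} {dT : measure_display} {T : measurableType dT}.
Variables (P : probability T R) (C : finType) (c : T -> C).
Hypothesis mc : forall y, measurable [set t | c t = y]%classic.

(** Expansion over level sets reduces boundedness, measurability and means to indicators. *)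
Lemma finite_valuedE (h : C -> R) t :
  h (c t) = \sum_y h y * \1_[set t | c t = y]%classic t.
Proof.
rewrite (bigD1 (c t)) //= big1 => [|y yc]; last first.
  rewrite indicE (_ : _ \in _ = false) ?mulr0 //; apply/negbTE/negP.
  by rewrite inE /= => cy; rewrite cy eqxx in yc.
by rewrite addr0 indicE mem_set ?mulr1.
Qed.

Lemma bounded_rv_indic y : bounded_rv (\1_[set t | c t = y]%classic : T -> R).
Proof.
split; first exact: measurable_indic.
by exists 1 => t; rewrite indicE; case: (_ \in _); rewrite ?normr1 ?normr0.
Qed.

Lemma bounded_rv_finite (h : C -> R) : bounded_rv (fun t => h (c t)).
Proof.
under eq_fun do rewrite finite_valuedE.
by apply: bounded_rv_sum => y; apply: bounded_rvM; [exact: bounded_rv_cst|exact: bounded_rv_indic].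
Qed.

Lemma mean_finite (h : C -> R) :
  mean P (fun t => h (c t)) = \sum_y h y * fine (P [set t | c t = y]%classic).
Proof.
under eq_mean do rewrite finite_valuedE.
rewrite mean_sum => [|y]; last first.
  by apply: bounded_rvM; [exact: bounded_rv_cst|exact: bounded_rv_indic].
apply: eq_bigr => y _; rewrite meanZ; last exact: bounded_rv_indic.
by congr (_ * _); rewrite /mean /Rintegral integral_indic ?setIT.
Qed.

End FiniteValued.

(** * Covariances of the steps, computed from the law of the walk *)

Section Law.
Context {R : realType} {dT : measure_display} {T : measurableType dT}.
Variables (P : probability T R) (d : nat) (p : R) (X : nat -> T -> dir d).
Hypothesis d_gt0 : (0 < d)%N.
Hypothesis mX : forall k (x : dir d), measurable [set t | X k t = x]%classic.
Hypothesis lawX : forall (n : nat) (xs : nat -> dir d),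
  P [set t | forall k, (1 <= k <= n)%N -> X k t = xs k]%classic = (erw_prob p xs n)%:E.

Local Notation a := ((2 * d%:R * p - 1) / (2 * d%:R - 1)).

Lemma eq_erw_prob (xs ys : nat -> dir d) n :
  (forall k, (1 <= k <= n)%N -> xs k = ys k) -> erw_prob p xs n = erw_prob p ys n.
Proof.
elim: n => [//|[//|n] IH] e; rewrite /= -/(erw_prob _ _ n.+1) -/(erw_prob _ _ n.+1).
congr (_ * _).
  by apply: IH => k /andP[k1 kn]; apply: e; rewrite k1 leqW.
congr (_ * _); rewrite !big_nat; apply: eq_bigr => k /andP[k1 kn].
by rewrite !e //= k1 leqW.
Qed.

(** As a finite function, the past ranges over a finite type, so expectations become finite sums;
    entry i is the step at time i + 1. *)
Definition path_prefix n t : {ffun 'I_n -> dir d} := [ffun i => X (val i).+1 t].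

(** Time k reads entry k - 1 and [y] fills the times after n. By truncated subtraction time 0 reads
    as time 1, which is harmless because cylinders start at time 1. *)
Definition path_extend n (f : {ffun 'I_n -> dir d}) (y : dir d) k : dir d :=
  if insub k.-1 is Some i then f i else y.

Lemma path_extendE n (f : {ffun 'I_n -> dir d}) y (i : 'I_n) :
  path_extend f y i.+1 = f i.
Proof. by rewrite /path_extend /= valK. Qed.

Lemma path_extend_last n (f : {ffun 'I_n -> dir d}) y : path_extend f y n.+1 = y.
Proof. by rewrite /path_extend /= insubF ?ltnn. Qed.

Lemma path_prefix_set n (f : {ffun 'I_n -> dir d}) y :
  [set t | path_prefix n t = f]%classic =
  [set t | forall k, (1 <= k <= n)%N -> X k t = path_extend f y k]%classic.
Proof.
apply/seteqP; split => t /=.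
  move=> <- [//|k] /andP[_ kn].
  by rewrite (path_extendE _ y (Ordinal kn)) ffunE.
by move=> h; apply/ffunP => i; rewrite ffunE h ?path_extendE //= ltn_ord.
Qed.

Lemma path_prefix_last_set n (f : {ffun 'I_n -> dir d}) y :
  [set t | (path_prefix n t, X n.+1 t) = (f, y)]%classic =
  [set t | forall k, (1 <= k <= n.+1)%N -> X k t = path_extend f y k]%classic.
Proof.
apply/seteqP; split => t /=.
  move=> [fE yE] [//|k] /andP[_]; rewrite ltnS leq_eqVlt => /predU1P[->|kn].
    by rewrite path_extend_last.
  by rewrite (path_extendE _ y (Ordinal kn)) -fE ffunE.
move=> h; congr (_, _); last by rewrite h ?path_extend_last /= ?ltnS.
by apply/ffunP => i; rewrite ffunE h ?path_extendE //= ltnS ltnW.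
Qed.

Lemma measurable_cylinder n xs :
  measurable [set t | forall k, (1 <= k <= n)%N -> X k t = xs k]%classic.
Proof.
rewrite (_ : [set _ | _]%classic = (\bigcap_k (if (1 <= k <= n)%N then
    [set t | X k t = xs k] else setT))%classic); last first.
  apply/seteqP; split => t /= h k => [_|kn]; first by case: ifP => // kn; exact: h.
  by have := h k I; rewrite kn.
by apply: bigcapT_measurable => k; case: ifP => _; [exact: mX|exact: measurableT].
Qed.

Lemma measurable_path_prefix n (f : {ffun 'I_n -> dir d}) :
  measurable [set t | path_prefix n t = f]%classic.
Proof.
rewrite (path_prefix_set f (Ordinal d_gt0, true)); exact: measurable_cylinder.
Qed.

Lemma measurable_path_prefix_last n (fy : {ffun 'I_n -> dir d} * dir d) :
  measurable [set t | (path_prefix n t, X n.+1 t) = fy]%classic.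
Proof. by case: fy => f y; rewrite path_prefix_last_set; exact: measurable_cylinder. Qed.

(** The filler direction exists because d > 0; by [eq_erw_prob] its choice does not affect the
    value. *)
Definition path_prob n (f : {ffun 'I_n -> dir d}) : R :=
  erw_prob p (path_extend f (Ordinal d_gt0, true)) n.

Lemma mean_path_prefix n (h : {ffun 'I_n -> dir d} -> R) :
  mean P (fun t => h (path_prefix n t)) = \sum_f h f * path_prob f.
Proof.
rewrite mean_finite; last exact: measurable_path_prefix.
apply: eq_bigr => f _; congr (_ * _).
by rewrite (path_prefix_set f (Ordinal d_gt0, true)) lawX.
Qed.

(** The transition rule in integrated form: a finite sum over pasts replaces conditional
    expectation. The past has length n + 1, so the special case of the first step does not occur. *)
Lemma mean_path_prefix_last n (h : {ffun 'I_n.+1 -> dir d} -> dir d -> R) :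
  mean P (fun t => h (path_prefix n.+1 t) (X n.+2 t)) =
  \sum_f path_prob f * (n.+1%:R^-1 * \sum_(j < n.+1) \sum_y erw_weight p (f j) y * h f y).
Proof.
rewrite (@mean_finite _ _ _ P _ (fun t => (path_prefix n.+1 t, X n.+2 t))
  (@measurable_path_prefix_last n.+1) (fun fy => h fy.1 fy.2)) /=.
pose F f y := h f y *
  fine (P [set t | (path_prefix n.+1 t, X n.+2 t) = (f, y)]%classic).
rewrite (eq_bigr (fun q => F q.1 q.2)); last by case.
rewrite -(pair_bigA _ F) /=.
apply: eq_bigr => f _.
rewrite exchange_big /= !big_distrr /=; apply: eq_bigr => y _.
have eP : erw_prob p (path_extend f y) n.+1 = path_prob f.
  apply: eq_erw_prob => -[//|k] /andP[_ kn].
  by rewrite !(path_extendE f _ (Ordinal kn)).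
have eW : \sum_(1 <= k < n.+2) erw_weight p (path_extend f y k) (path_extend f y n.+2) =
    \sum_(j < n.+1) erw_weight p (f j) y.
  rewrite big_add1 big_mkord; apply: eq_bigr => j _.
  by rewrite path_extendE path_extend_last.
have -> : F f y = h f y * (erw_prob p (path_extend f y) n.+1 * (n.+1%:R^-1 *
    \sum_(1 <= k < n.+2) erw_weight p (path_extend f y k) (path_extend f y n.+2))).
  by rewrite /F path_prefix_last_set lawX.
by rewrite eP eW -big_distrl /=; ring.
Qed.

(** A function of zero sum is an eigenvector of the weight matrix, with eigenvalue p - (1 - p) / (2d
    - 1), which equals a. *)
Lemma sum_erw_weight (phi : dir d -> R) x : \sum_y phi y = 0 ->
  \sum_y erw_weight p x y * phi y = a * phi x.
Proof.
move=> phi0.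
rewrite (bigD1 x) //= {1}/erw_weight eqxx.
rewrite (eq_bigr (fun y => (1 - p) / (2 * d - 1)%:R * phi y)); last first.
  by move=> y yx; rewrite /erw_weight eq_sym (negbTE yx).
rewrite -big_distrr /=.
have -> : \sum_(y | y != x) phi y = - phi x.
  by apply/eqP; rewrite -addr_eq0 addrC -[X in _ == X]phi0 [X in _ == X](bigD1 x).
(* The truncated subtraction is a true one because d > 0. *)
have dE : (2 * d - 1)%:R = 2 * d%:R - 1 :> R by rewrite natrB ?muln_gt0 // natrM.
have d0 : 2 * d%:R - 1 != 0 :> R.
  by rewrite -dE pnatr_eq0 -lt0n subn_gt0 leq_pmulr.
by rewrite dE; field.
Qed.

(** This supplies [covx]: the weight matrix acts on each candidate past step j as multiplication by
    a, and j is uniform. *)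
Lemma mean_step_cov (phi : dir d -> R) k n : \sum_y phi y = 0 -> (k <= n)%N ->
  mean P (fun t => phi (X k.+1 t) * phi (X n.+2 t)) =
  a / n.+1%:R * \sum_(j < n.+1) mean P (fun t => phi (X k.+1 t) * phi (X j.+1 t)).
Proof.
move=> phi0 kn; pose i := Ordinal (kn : (k < n.+1)%N).
pose h (f : {ffun 'I_n.+1 -> dir d}) y := phi (f i) * phi y.
have -> : mean P (fun t => phi (X k.+1 t) * phi (X n.+2 t)) =
    mean P (fun t => h (path_prefix n.+1 t) (X n.+2 t)).
  by apply: eq_mean => t /=; rewrite /h ffunE.
have e (j : 'I_n.+1) : mean P (fun t => phi (X k.+1 t) * phi (X j.+1 t)) =
    \sum_(f : {ffun 'I_n.+1 -> dir d}) phi (f i) * phi (f j) * path_prob f.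
  by rewrite -mean_path_prefix; apply: eq_mean => t; rewrite !ffunE.
rewrite mean_path_prefix_last (eq_bigr _ (fun j _ => e j)).
rewrite exchange_big /= big_distrr /=; apply: eq_bigr => f _.
under eq_bigr => j _.
  under eq_bigr => y _ do rewrite /h mulrCA.
  rewrite -big_distrr /= sum_erw_weight //.
  over.
rewrite !big_distrr /=; apply: eq_bigr => j _; ring.
Qed.

Lemma mean_first_step (h : dir d -> R) :
  mean P (fun t => h (X 1 t)) = (2 * d)%:R^-1 * \sum_y h y.
Proof.
rewrite mean_finite // big_distrr /=; apply: eq_bigr => y _; rewrite mulrC; congr (_ * _).
rewrite (_ : [set t | X 1 t = y]%classic =
  [set t | forall k, (1 <= k <= 1)%N -> X k t = y]%classic); first by rewrite (lawX 1 (fun=> y)).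
apply/seteqP; split => t /= h1; last exact: h1.
by move=> k /andP[k1 k2]; have -> : k = 1%N by apply/eqP; rewrite eqn_leq k1 k2.
Qed.

End Law.

Lemma cvg_row (R : realType) (d : nat) (v : nat -> 'rV[R]_d) (w : 'rV[R]_d) :
  (forall i, ((fun n => v n 0 i) @ \oo --> w 0 i)%classic) ->
  (v @ \oo --> w)%classic.
Proof.
move=> vw; apply/cvg_ballP => e e0.
have h : (\forall n \near \oo, forall i, ball (w 0 i) e (v n 0 i))%classic.
  by apply: filter_forall => i; have /cvg_ballP := vw i; apply.
by apply: filterS h => n h; split => // i j; rewrite (ord1 i).
Qed.

(** * Projection of the walk on a fixed vector *)

Section Directional.
Context {R : realType} {dT : measure_display} {T : measurableType dT}.
Variables (P : probability T R) (d : nat) (p : R) (X : nat -> T -> dir d).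
Hypothesis d_gt0 : (0 < d)%N.
Hypothesis p01 : 0 <= p <= 1.
Hypothesis p_gt : (2 * d + 1)%:R / (4 * d)%:R < p.
Hypothesis mX : forall k (x : dir d), measurable [set t | X k t = x]%classic.
Hypothesis lawX : forall (n : nat) (xs : nat -> dir d),
  P [set t | forall k, (1 <= k <= n)%N -> X k t = xs k]%classic = (erw_prob p xs n)%:E.

Local Notation a := ((2 * d%:R * p - 1) / (2 * d%:R - 1)).

Definition dvec_dot (u : 'rV[R]_d) (y : dir d) : R := \sum_i u 0 i * dvec y 0 i.

Definition projected_step u k t : R := dvec_dot u (X k.+1 t).

Lemma dvec_dotE u y : dvec_dot u y = if y.2 then u 0 y.1 else - u 0 y.1.
Proof.
rewrite /dvec_dot (bigD1 y.1) //= big1 => [|i iy]; last first.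
  by rewrite mxE (negbTE iy) mulr0.
by rewrite mxE eqxx addr0; case: y.2; rewrite ?mulr1 ?mulrN1.
Qed.

(** Opposite directions cancel, so a linear projection is an eigenvector of the weights and has mean
    zero under the uniform law. *)
Lemma sum_dvec_dot u : \sum_y dvec_dot u y = 0.
Proof.
rewrite (eq_bigr (fun q : dir d => (fun i b => dvec_dot u (i, b)) q.1 q.2)); last by case.
rewrite -(pair_bigA _ (fun i b => dvec_dot u (i, b))) /= big1 // => i _.
by rewrite big_bool !dvec_dotE /= addrN.
Qed.

Lemma sum_sqr_dvec_dot_gt0 u : u != 0 -> 0 < \sum_y dvec_dot u y ^+ 2.
Proof.
move=> u0; have [i ui] : exists i, u 0 i != 0.
  apply/existsP; apply: contraNT u0; rewrite negb_exists => /forallP h.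
  by apply/eqP/rowP => i; rewrite mxE; apply/eqP; rewrite -[_ == _]negbK h.
rewrite (bigD1 (i, true)) //= ltr_pwDl //.
  by rewrite dvec_dotE /= exprn_even_gt0 //= orbC ui.
by apply: sumr_ge0 => y _; rewrite sqr_ge0.
Qed.

(** Cleared of denominators, 2a > 1 reads 4dp > 2d + 1, the superdiffusive condition; a <= 1 comes
    from p <= 1. *)
Lemma superdiffusive_exponent : 1 < 2 * a /\ a <= 1.
Proof.
have d1 : (1 : R) <= d%:R by rewrite ler1n.
have /andP[_ p1] := p01.
have := p_gt; rewrite natrD !natrM ltr_pdivrMr; last by lra.
move=> h; have c0 : 0 < 2 * d%:R - 1 :> R by lra.
split; last by rewrite ler_pdivrMr // mul1r; nra.
by rewrite mulrA ltr_pdivlMr //; nra.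
Qed.

Lemma scaled_barycentre_dot u n t :
  scaled_barycentre a (projected_step u) n t =
  \sum_i u 0 i * ((n%:R `^ a)^-1 *: erw_bary X n t) 0 i.
Proof.
rewrite /scaled_barycentre.
under [RHS]eq_bigr => i _.
  rewrite /erw_bary !mxE mulrCA [u 0 i * _]mulrCA summxE.
  rewrite (eq_bigr (fun k => \sum_(1 <= j < k.+1) dvec (X j t) 0 i)); last first.
    by move=> k _; rewrite /erw_pos summxE.
  over.
rewrite -!big_distrr /=; congr (_ * (_ * _)).
under [RHS]eq_bigr => i _ do rewrite big_distrr /=.
rewrite exchange_big /=; apply: eq_bigr => k _.
under [RHS]eq_bigr => i _ do rewrite big_distrr /=.
(* The range starts at 1, so [j.-1.+1] is [j]. *)
rewrite [RHS]exchange_big /=; apply: eq_big_nat => j /andP[j1 _].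
by rewrite /projected_step /dvec_dot prednK.
Qed.

Lemma bounded_rv_erw_bary n i : bounded_rv (fun t => erw_bary X n t 0 i : R).
Proof.
rewrite (_ : (fun _ => _) = (fun t => n%:R^-1 *
    \sum_(1 <= k < n.+1) \sum_(1 <= j < k.+1) dvec (X j t) 0 i)); last first.
  apply/funext => t; rewrite /erw_bary mxE summxE; congr (_ * _).
  by apply: eq_bigr => k _; rewrite /erw_pos summxE.
bounded_rv.
by apply: (bounded_rv_finite (mX _) (fun y => dvec y 0 i)).
Qed.

Lemma directional_cvg u : u != 0 -> exists W : T -> R,
  [/\ measurable_fun setT W,
      forall c, (P [set t | W t = c]%classic < 1%:E)%E,
      {ae P, forall t,
        ((fun n => scaled_barycentre a (projected_step u) n t) @ \oo --> W t)%classic} &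
      ((fun n => \int[P]_t ((scaled_barycentre a (projected_step u) n t - W t) ^+ 2)%:E)%E
         @ \oo --> 0%:E)%classic].
Proof.
move=> u0; have [a_half a_le1] := superdiffusive_exponent.
have bstep k : bounded_rv (projected_step u k).
  by apply: (bounded_rv_finite (mX k.+1)).
(* The variance constant is crude: the square of one projected direction is at most the sum over all
   of them. *)
apply: (@scaled_barycentre_cvg _ _ _ P a (\sum_y dvec_dot u y ^+ 2)) => //.
- move=> k; rewrite -[leRHS](mean_cst P).
  apply: ler_mean; [by bounded_rv..|move=> t].
  rewrite /projected_step (bigD1 (X k.+1 t)) //= lerDl.
  by apply: sumr_ge0 => y _; rewrite sqr_ge0.
- move=> k n kn; exact: (mean_step_cov d_gt0 mX lawX (sum_dvec_dot u) kn).
- by rewrite /projected_step (mean_first_step mX lawX) sum_dvec_dot mulr0.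
- rewrite /projected_step (mean_first_step mX lawX (fun y => dvec_dot u y ^+ 2)).
  by rewrite mulr_gt0 ?sum_sqr_dvec_dot_gt0 // invr_gt0 ltr0n muln_gt0.
Qed.

End Directional.

(** * Assembly of the vector limit from its projections *)

Unset Implicit Arguments. Set Strict Implicit.

Theorem theorem2p7 (R : realType) (dT : measure_display) (T : measurableType dT)
  (P : probability T R) (d : nat) (p : R) (X : nat -> T -> dir d) :
  (0 < d)%N -> 0 <= p <= 1 -> ((2 * d + 1)%:R / (4 * d)%:R < p) ->
  (* each step X_k (k >= 1) is a random variable with values in the 2d directions *)
  (forall k (x : dir d), measurable [set t | X k t = x]%classic) ->
  (* the law of (X_1, ..., X_n) is that of the d-dimensional ERW with parameter p *)
  (forall (n : nat) (xs : nat -> dir d),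
     P [set t | forall k, (1 <= k <= n)%N -> X k t = xs k]%classic = (erw_prob p xs n)%:E) ->
  let a := (2 * d%:R * p - 1) / (2 * d%:R - 1) in
  exists G : T -> 'rV[R]_d,
    (forall i : 'I_d, measurable_fun setT (fun t => G t 0 i)) /\
    (* non-degenerate: the law of G is not carried by any affine hyperplane *)
    (forall (u : 'rV[R]_d) (c : R), u != 0 ->
       (P [set t | (\sum_(i < d) u 0 i * G t 0 i = c)%R]%classic < 1%:E)%E) /\
    {ae P, forall t, ((fun n : nat => ((n%:R `^ a)^-1 *: erw_bary X n t)) @ \oo --> G t)%classic} /\
    ((fun n : nat =>
        (\int[P]_t (sqnorm ((n%:R `^ a)^-1 *: erw_bary X n t - G t))%:E)%E)
       @ \oo --> 0%:E)%classic.
Proof.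
move=> d0 p01 p_gt mX lawX a.
pose V n t : 'rV[R]_d := (n%:R `^ a)^-1 *: erw_bary X n t.
have dirW (u : 'rV[R]_d) : u != 0 -> exists W : T -> R,
  [/\ measurable_fun setT W,
      forall c, (P [set t | W t = c]%classic < 1%:E)%E,
      {ae P, forall t, ((fun n => \sum_i u 0 i * V n t 0 i) @ \oo --> W t)%classic} &
      ((fun n => \int[P]_t ((\sum_i u 0 i * V n t 0 i - W t) ^+ 2)%:E)%E
         @ \oo --> 0%:E)%classic].
  move=> /(directional_cvg d0 p01 p_gt mX lawX)[W [mW ndW cW iW]].
  have sbE : scaled_barycentre a (projected_step X u) =
      (fun n t => \sum_i u 0 i * V n t 0 i).
    by apply/funext => n; apply/funext => t; exact: scaled_barycentre_dot.
  by rewrite sbE in cW iW; exists W.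
have e0 (i : 'I_d) : delta_mx 0 i != 0 :> 'rV[R]_d.
  by apply/eqP => /rowP/(_ i); rewrite !mxE !eqxx => /eqP; rewrite oner_eq0.
have eV (i : 'I_d) (v : 'rV[R]_d) : \sum_j (delta_mx 0 i : 'rV[R]_d) 0 j * v 0 j = v 0 i.
  rewrite (bigD1 i) //= big1 => [|j ji]; first by rewrite mxE !eqxx mul1r addr0.
  by rewrite mxE eqxx (negbTE ji) mul0r.
(* The coordinates of the limit are the scalar limits along the basis vectors. *)
have [W HW] := choice (fun i => dirW _ (e0 i)).
pose G t : 'rV[R]_d := \row_i W i t.
have mG (i : 'I_d) : measurable_fun setT (fun t => G t 0 i).
  have [mW _ _ _] := HW i.
  by rewrite (_ : (fun _ => _) = W i) //; apply/funext => t; rewrite mxE.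
have cG : {ae P, forall t, ((fun n => V n t) @ \oo --> G t)%classic}.
  have : {ae P, forall t, forall i, ((fun n => V n t 0 i) @ \oo --> W i t)%classic}.
    apply: filter_forall => i; have [_ _ cW _] := HW i.
    by apply: filterS cW => t; under eq_fun do rewrite eV.
  by apply: filterS => t h; apply: cvg_row => i; rewrite mxE; exact: h.
exists G; split => //; split; last split => //.
(* Non-degenerate coordinates would not suffice, so the scalar result is applied to [u] itself;
   uniqueness of limits identifies its limit with the projection of G almost surely. *)
- move=> u c u0; have [Wu [mWu ndWu cWu _]] := dirW u u0.
  have uG : {ae P, forall t, \sum_i u 0 i * G t 0 i = Wu t}.
    have : {ae P, forall t, forall i, ((fun n => V n t 0 i) @ \oo --> G t 0 i)%classic}.
      apply: filter_forall => i; have [_ _ cW _] := HW i.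
      by apply: filterS cW => t; under eq_fun do rewrite eV; rewrite mxE.
    apply: filterS2 cWu => t cu ci.
    have cs : ((fun n => \sum_i u 0 i * V n t 0 i) @ \oo -->
        \sum_i u 0 i * G t 0 i)%classic.
      apply: cvg_big => [|i _]; first exact: add_continuous.
      by apply: cvgM; [exact: cvg_cst | exact: ci].
    exact: (norm_cvg_unique cs cu).
  have mu : measurable_fun setT (fun t => \sum_i u 0 i * G t 0 i).
    by apply: measurable_sum => i; apply: measurable_funM.
  have meas_eq (f : T -> R) : measurable_fun setT f -> measurable [set t | f t = c]%classic.
    by move=> mf; have := mf measurableT [set c]%classic (measurable_set1 c); rewrite setTI.
  rewrite (_ : P _ = P [set t | Wu t = c]%classic) //.
  (* Written as integrals of indicators, the two probabilities agree because the integrands agree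
     almost everywhere. *)
  have ind (f : T -> R) : measurable_fun setT f ->
      P [set t | f t = c]%classic = (\int[P]_t (\1_[set t | f t = c]%classic t)%:E)%E.
    by move=> mf; rewrite integral_indic ?setIT //; exact: meas_eq.
  rewrite !ind //; apply: ae_eq_integral => //.
  + by apply/measurable_EFinP; apply: measurable_indic; exact: meas_eq.
  + by apply/measurable_EFinP; apply: measurable_indic; exact: meas_eq.
  + apply: filterS uG => t e _; rewrite !indicE.
    rewrite (_ : (t \in _) = (t \in [set t | Wu t = c]%classic)) //.
    by apply/idP/idP; rewrite !inE /= e.
(* The expected squared norm splits into finitely many coordinate errors, each tending to 0 by the
   scalar result. *)
- have -> : (fun n => \int[P]_t (sqnorm ((n%:R `^ a)^-1 *: erw_bary X n t - G t))%:E)%E =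
      (fun n => \sum_i \int[P]_t ((V n t 0 i - G t 0 i) ^+ 2)%:E)%E.
    apply/funext => n; rewrite -ge0_integral_sum //.
    + by apply: eq_integral => t _; rewrite /sqnorm sumEFin; congr (_%:E);
        apply: eq_bigr => i _; rewrite !mxE.
    + move=> i; apply/measurable_EFinP; apply: (measurable_funX 2).
      apply: measurable_funB => //.
      rewrite (_ : (fun _ => _) = (fun t => (n%:R `^ a)^-1 * erw_bary X n t 0 i)).
        by apply: measurable_funM => //; have [] := @bounded_rv_erw_bary R _ _ _ _ mX n i.
      by apply/funext => t; rewrite mxE.
    + by move=> i t _; rewrite lee_fin sqr_ge0.
  rewrite [X in (_ --> X)%classic](_ : _ = (\sum_(i < d) 0%:E)%E); last by rewrite big1.
  apply: cvg_nnesum => i _.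
    by apply: nearW => n; apply: integral_ge0 => t _; rewrite lee_fin sqr_ge0.
  have [_ _ _ iW] := HW i.
  have -> : (fun n => \int[P]_t ((V n t 0 i - G t 0 i) ^+ 2)%:E)%E = (fun n => \int[P]_t
      ((\sum_j (delta_mx 0 i : 'rV[R]_d) 0 j * V n t 0 j - W i t) ^+ 2)%:E)%E.
    by apply/funext => n; apply: eq_integral => t _; rewrite eV [G t 0 i]mxE.
  exact: iW.
Qed.
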